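(* Let $A$ be a real finite-dimensional affine space. If $m\in\mathrm{Met}(A)$ is a metric on $A$ with signature $(\pi,\nu,\rho)$, then $\mathrm{CM}_m$ is a symmetric bilinear form on $\mathrm{Aff}(\mathrm{Quad}_mA)$ with signature $(\nu+1,\pi+1,\rho)$.
   Context: All spaces are real and finite-dimensional. For an affine space $A$ with director vector space $\vec A$: $\mathrm{Aff}(A)$ is the vector space of affine functions $A\to\mathbb R$, $u$ the constant function $1$. The linear hull is $\widehat A=(\mathrm{Aff}(A))^*$; $z_P\in\widehat A$ is evaluation at $P$; $A$ is identified with $\{z:\langle z,u\rangle=1\}$ and $\vec A$ with $\{z:\langle z,u\rangle=0\}$, $\overrightarrow{PQ}=z_Q-z_P$. A function $\delta:A\to\mathbb R$ is quadratic if $\delta(\alpha P+\beta Q)=\alpha(\alpha-\beta)\delta(P)+\beta(\beta-\alpha)\delta(Q)+4\alpha\beta\,\delta(\frac{P+Q}2)$ whenever $\alpha+\beta=1$; $\mathrm{Quad}(A)$ is the vector space of these. Each $\delta\in\mathrm{Quad}(A)$ has a symmetric bilinear form $\mathrm{Hess}\,\delta$ on $\vec A$ (hessian principal component), characterized by $\frac12(\delta(Q)+\delta(2P-Q))-\delta(P)=\frac12\mathrm{Hess}\,\delta(\overrightarrow{PQ},\overrightarrow{PQ})$. $\mathrm{Met}(A)=\mathrm{Quad}(A)/\mathrm{Aff}(A)$ is the space of metrics; for $m\in\mathrm{Met}(A)$, $\mathrm{Quad}_mA\subset\mathrm{Quad}(A)$ is the class $m$, an affine space with director space $\mathrm{Aff}(A)$;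 its elements share the same hessian principal component $g$ (that of $m$). $\delta^m_P\in\mathrm{Quad}_mA$ is $\delta^m_P(Q)=\frac12g(\overrightarrow{PQ},\overrightarrow{PQ})$. The signature (inertia index) of a symmetric bilinear form is (maximal dimension of a positive definite subspace, maximal dimension of a negative definite subspace, dimension of the nullspace); the signature of $m$ is that of $g$. $\mathrm{Aff}(\mathrm{Quad}_mA)$ is the vector space of affine functionals $\mathrm{Quad}_mA\to\mathbb R$; its dual is $\widehat{\mathrm{Quad}_mA}$, in which $\mathrm{Quad}_mA$ is embedded by evaluation. $v_P(\delta)=\delta(P)$ for $P\in A$. $\mathrm d_m:\mathrm{Aff}(\mathrm{Quad}_mA)\to\widehat A$, $\langle\mathrm d_m\bar v,s\rangle=\bar v(\delta+s)-\bar v(\delta)$, $s\in\mathrm{Aff}(A)$ (any $\delta\in\mathrm{Quad}_mA$). $\mathrm{Aff}_0(\mathrm{Quad}_mA)$ is the subspace of $\bar v$ with $\bar v(\delta+\alpha u)=\bar v(\delta)$ for all $\delta,\alpha$; $\mathrm d_m$ maps it into $\vec A$. The Cayley–Menger form $\mathrm{CM}_m$ is the unique symmetric bilinear form on $\mathrm{Aff}(\mathrm{Quad}_mA)$ with (1) $\mathrm{CM}_m(v_1,v_2)=-g(\mathrm d_mv_1,\mathrm d_mv_2)$ for $v_1,v_2\in\mathrm{Aff}_0(\mathrm{Quad}_mA)$ and (2) $\mathrm{CM}_m(v_P,\cdot)=\delta^m_P$ in $\widehat{\mathrm{Quad}_mA}$ for all $P\in A$ (for $m\ne0$, (2) may equivalently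 be replaced by $\mathrm{CM}_m(v_P,v_P)=0$ for all $P\in A$). *)

(* Defs.v *)
From HB Require Import structures.
From mathcomp Require Import all_boot all_order all_algebra.
From mathcomp Require Import sesquilinear generic_quotient ring_quotient.
From mathcomp Require Import mathcomp_extra boolp classical_sets functions reals.
From mathcomp Require Import ring lra.

Set Implicit Arguments.
Unset Strict Implicit.
Unset Printing Implicit Defensive.

Import Order.TTheory GRing.Theory Num.Theory.
Local Open Scope ring_scope.
Local Open Scope quotient_scope.

(* Affine spaces: inhabited torsors under a finite-dimensional real vector space
   [V]; [avec P Q] is the vector from [P] to [Q]. *)
HB.mixin Record isAffineSpace (R : realType) (V : vectType R) (A : Type) := {
  atrans : A -> V -> A;
  avec : A -> A -> V;
  atransD : forall P v w, atrans P (v + w) = atrans (atrans P v) w;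
  avecK : forall P Q, atrans P (avec P Q) = Q;
  atransK : forall P v, avec P (atrans P v) = v;
  affine_space_inhabited : inhabited A
}.

#[short(type="affSpaceType")]
HB.structure Definition AffineSpace (R : realType) (V : vectType R) :=
  { A of isAffineSpace R V A }.

Notation "P +> v" := (atrans P v) (at level 50, left associativity) : ring_scope.

Section AffineSpaceTheory.
Context {R : realType} {V : vectType R} {A : affSpaceType V}.
Implicit Types (P Q O : A) (v w : V) (f d : A -> R^o).

Definition origin : A := inhabited_witness affine_space_inhabited.

Lemma atrans0 P : P +> 0 = P.
Proof.
suff e : avec P P = 0 by rewrite -[RHS](avecK P) e.
have := atransK P (avec P P + avec P P); rewrite atransD !avecK.
by move/eqP; rewrite -subr_eq0 opprD addrA subrr sub0r oppr_eq0 => /eqP.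
Qed.

(* The point [a P + b Q]; only meaningful when [a + b = 1], see [avec_comb]. *)
Definition comb (a b : R) P Q : A := P +> b *: avec P Q.

Lemma avecD P Q O : avec P O = avec P Q + avec Q O.
Proof.
by rewrite -[X in avec P X = _](avecK Q O) -[X in avec P (X +> _)](avecK P Q)
  -atransD atransK.
Qed.

Lemma avec_comb O a b P Q : a + b = 1 ->
  avec O (comb a b P Q) = a *: avec O P + b *: avec O Q.
Proof.
move=> ab; rewrite /comb (avecD O P) atransK (avecD O P Q) scalerDr addrA.
by rewrite -scalerDl ab scale1r.
Qed.

Lemma comb_trans P v w a b : a + b = 1 ->
  comb a b (P +> v) (P +> w) = P +> (a *: v + b *: w).
Proof.
move=> ab; rewrite -[LHS](avecK P) (avec_comb P _ _ ab) !atransK //.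
Qed.

Definition affine f := forall (a b : R) P Q, a + b = 1 ->
  f (comb a b P Q) = a * f P + b * f Q.

Definition quadratic d := forall (a b : R) P Q, a + b = 1 ->
  d (comb a b P Q) = a * (a - b) * d P + b * (b - a) * d Q
                     + 4 * a * b * d (comb 2^-1 2^-1 P Q).

Definition affine_fun : {pred A -> R^o} := [pred f | `[< affine f >]].
Definition quadratic_fun : {pred A -> R^o} := [pred d | `[< quadratic d >]].

Fact affine_fun_submod : submod_closed affine_fun.
Proof.
split=> [|c f g /asboolP fA /asboolP gA]; apply/asboolP => a b P Q ab.
  by rewrite !mulr0 addr0.
rewrite !fctE (fA _ _ _ _ ab) (gA _ _ _ _ ab).
rewrite /GRing.scale /=; ring.
Qed.

Fact quadratic_fun_submod : submod_closed quadratic_fun.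
Proof.
split=> [|c f g /asboolP fA /asboolP gA]; apply/asboolP => a b P Q ab.
  by rewrite !mulr0 !addr0.
rewrite !fctE (fA _ _ _ _ ab) (gA _ _ _ _ ab).
rewrite /GRing.scale /=; ring.
Qed.


Lemma affineZ f P c v : affine f ->
  f (P +> c *: v) = f P + c * (f (P +> v) - f P).
Proof.
move=> fA; have /(fA _ _ P (P +> v)) : (1 - c) + c = 1 by ring.
by rewrite /comb atransK => ->; ring.
Qed.

Lemma affineD f P v w : affine f ->
  f (P +> (v + w)) = f (P +> v) + f (P +> w) - f P.
Proof.
move=> fA; have h : (2^-1 + 2^-1 : R) = 1 by lra.
have := fA _ _ (P +> 2 *: v) (P +> 2 *: w) h.
rewrite (comb_trans _ _ _ h) !scalerA mulVf ?pnatr_eq0// !scale1r => ->.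
rewrite !affineZ //; by field.
Qed.

Lemma affine_trans f P Q v : affine f -> f (P +> v) - f P = f (Q +> v) - f Q.
Proof.
move=> fA; rewrite -(avecK Q P) -atransD affineD //; ring.
Qed.

Lemma affine_linear f O c (L : V -> R) : linear_for *%R L ->
  (forall P, f P = c + L (avec O P)) -> affine f.
Proof.
move=> LL fE a b P Q ab; rewrite !fE (avec_comb O P Q ab).
have L0 : L 0 = 0.
  have := LL (-1) 0 0; rewrite scaler0 addr0 mulN1r => h; lra.
have -> : b *: avec O Q = b *: avec O Q + 0 by rewrite addr0.
rewrite LL LL L0; have -> : b = 1 - a by lra.
ring.
Qed.

Lemma quadratic_line d P v t : quadratic d ->
  d (P +> t *: v) = (1 - t) * (1 - 2 * t) * d P + t * (2 * t - 1) * d (P +> v)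
                    + 4 * t * (1 - t) * d (P +> 2^-1 *: v).
Proof.
move=> dQ; have /(dQ _ _ P (P +> v)) : (1 - t) + t = 1 by ring.
by rewrite /comb atransK => ->; ring.
Qed.

Lemma quadratic_line2 d P v t : quadratic d ->
  d (P +> t *: v) = (1 - t) * (2 - t) / 2 * d P + t * (t - 1) / 2 * d (P +> 2 *: v)
                    + t * (2 - t) * d (P +> v).
Proof.
move=> dQ; have := quadratic_line P (2 *: v) (t / 2) dQ.
rewrite !scalerA mulVf ?pnatr_eq0// divfK ?pnatr_eq0// scale1r => ->.
by field.
Qed.

Lemma quadratic_diff3 d P v : quadratic d ->
  d (P +> 3 *: v) = 3 * d (P +> 2 *: v) - 3 * d (P +> v) + d P.
Proof. by move=> dQ; rewrite (quadratic_line2 _ _ 3 dQ); by field. Qed.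

(* Polarization of [d], based at an arbitrary point (see [hessE]); it satisfies
   and is determined by the midpoint characterization, see [quadratic_hess] and
   [hessian_uniq]. *)
Definition hess d v w : R :=
  d (origin +> (v + w)) - d (origin +> v) - d (origin +> w) + d origin.

Lemma hessC d v w : hess d v w = hess d w v.
Proof. by rewrite /hess (addrC v w); ring. Qed.

(* Djokovic's identity: mixed third differences are combinations of
   third differences along lines. *)
Lemma quadratic_mixed d P x y z : quadratic d ->
  d (P +> (x + y + z)) - d (P +> (x + y)) - d (P +> (x + z)) - d (P +> (y + z))
  + d (P +> x) + d (P +> y) + d (P +> z) - d P = 0.
Proof.
move=> dQ.
pose f (a b c : R) := d (P +> (a *: x + b *: y + c *: z)).
have E (a b c a1 b1 c1 a2 b2 c2 a3 b3 c3 : R) :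
    [/\ a2 = 2 * a1 - a, b2 = 2 * b1 - b & c2 = 2 * c1 - c] ->
    [/\ a3 = 3 * a1 - 2 * a, b3 = 3 * b1 - 2 * b & c3 = 3 * c1 - 2 * c] ->
    f a3 b3 c3 = 3 * f a2 b2 c2 - 3 * f a1 b1 c1 + f a b c.
  move=> [-> -> ->] [-> -> ->].
  have H k a' b' c' : a' = k * a1 - (k - 1) * a -> b' = k * b1 - (k - 1) * b ->
    c' = k * c1 - (k - 1) * c -> f a' b' c' =
    d (P +> (a *: x + b *: y + c *: z)
         +> k *: ((a1 - a) *: x + (b1 - b) *: y + (c1 - c) *: z)).
    move=> -> -> ->; rewrite /f -atransD; congr (d (_ +> _)).
    rewrite !scalerDr !scalerA addrACA [X in _ = X + _]addrACA -!scalerDl.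
    by congr (_ *: _ + _ *: _ + _ *: _); ring.
  rewrite (H 3 (3 * a1 - 2 * a) (3 * b1 - 2 * b) (3 * c1 - 2 * c)); [|ring..].
  rewrite (H 2 (2 * a1 - a) (2 * b1 - b) (2 * c1 - c)); [|ring..].
  rewrite (H 1 a1 b1 c1); [|ring..].
  by rewrite scale1r quadratic_diff3.
have E001 := E 0 0 1 0 0 (2 / 3)
  0 0 (1 / 3) 0 0 0.
have E010 := E 0 1 0 0 (1 / 2) 0
  0 0 0 0 (- (1 / 2)) 0.
have E011 := E 0 1 1 0 (1 / 2) (2 / 3)
  0 0 (1 / 3) 0 (- (1 / 2)) 0.
have E100 := E 1 0 0 0 0 0
  (- 1) 0 0 (- 2) 0 0.
have E101 := E 1 0 1 0 0 (2 / 3)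
  (- 1) 0 (1 / 3) (- 2) 0 0.
have E110 := E 1 1 0 0 (1 / 2) 0
  (- 1) 0 0 (- 2) (- (1 / 2)) 0.
have E111 := E 1 1 1 0 (1 / 2) (2 / 3)
  (- 1) 0 (1 / 3) (- 2) (- (1 / 2)) 0.
have F0 a b c : f a b c = d (P +> (a *: x + b *: y + c *: z)) by [].
have := F0 1 1 1; have := F0 1 1 0; have := F0 1 0 1; have := F0 0 1 1.
have := F0 1 0 0; have := F0 0 1 0; have := F0 0 0 1; have := F0 0 0 0.
rewrite !scale1r !scale0r !add0r !addr0 atrans0 => <- <- <- <- <- <- <- <-.
have {}E001 : _ := E001 ltac:(split; by field) ltac:(split; by field).
have {}E010 : _ := E010 ltac:(split; by field) ltac:(split; by field).
have {}E011 : _ := E011 ltac:(split; by field) ltac:(split; by field).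
have {}E100 : _ := E100 ltac:(split; by field) ltac:(split; by field).
have {}E101 : _ := E101 ltac:(split; by field) ltac:(split; by field).
have {}E110 : _ := E110 ltac:(split; by field) ltac:(split; by field).
have {}E111 : _ := E111 ltac:(split; by field) ltac:(split; by field).
lra.
Qed.

Lemma hessE d P v w : quadratic d ->
  hess d v w = d (P +> (v + w)) - d (P +> v) - d (P +> w) + d P.
Proof.
move=> dQ; have := quadratic_mixed origin v w (avec origin P) dQ.
have E x : P +> x = origin +> (x + avec origin P) by rewrite addrC atransD avecK.
by rewrite /hess !E avecK => h; lra.
Qed.

Lemma hessDr d v w1 w2 : quadratic d -> hess d v (w1 + w2) = hess d v w1 + hess d v w2.
Proof.
move=> dQ; have := quadratic_mixed origin v w1 w2 dQ.
by rewrite /hess !addrA => h; lra.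
Qed.

Lemma hessZr d v w t : quadratic d -> hess d v (t *: w) = t * hess d v w.
Proof.
move=> dQ.
have D s : hess d v (s *: w) = (1 - s) * (1 - 2 * s) * hess d v 0
    + s * (2 * s - 1) * hess d v w + 4 * s * (1 - s) * hess d v (2^-1 *: w).
  rewrite /hess !atransD !(quadratic_line _ w s dQ) !atrans0; ring.
have D0 : hess d v 0 = 0 by rewrite /hess !addr0 atrans0; ring.
have D1 : hess d v w = 2 * hess d v (2^-1 *: w).
  have E : w = 2^-1 *: w + 2^-1 *: w.
    by rewrite -scalerDl -[LHS]scale1r; congr (_ *: _); field.
  by rewrite [in LHS]E hessDr //; ring.
by rewrite D D0 D1; ring.
Qed.

Lemma quadratic_hess d P Q : quadratic d ->
  2^-1 * (d Q + d (comb 2 (-1) P Q)) - d P = 2^-1 * hess d (avec P Q) (avec P Q).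
Proof.
move=> dQ; set v := avec P Q.
have -> : hess d v v = - hess d v (- v).
  by rewrite -scaleN1r hessZr //; ring.
rewrite (hessE P) // subrr atrans0 /comb scaleN1r -{1}(avecK P Q) -/v; by field.
Qed.

Lemma quadratic_sub_affine d P : quadratic d ->
  affine (fun Q => d Q - 2^-1 * hess d (avec P Q) (avec P Q) : R^o).
Proof.
move=> dQ.
apply: (@affine_linear _ P (d P) (fun v => d (P +> v) - d P - 2^-1 * hess d v v)).
  move=> t v w; rewrite [RHS]/=.
  have -> : d (P +> (t *: v + w)) = hess d (t *: v) w + d (P +> t *: v) + d (P +> w) - d P.
    by rewrite (hessE P) //; ring.
  have -> : hess d (t *: v + w) (t *: v + w) =
            t ^+ 2 * hess d v v + 2 * t * hess d v w + hess d w w.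
    by rewrite hessDr // hessZr // (hessC _ _ v) (hessC _ _ w) !hessDr //
       !hessZr // (hessC _ w v); ring.
  rewrite (hessC _ (t *: v) w) hessZr // (hessC _ w v).
  have h2 : d (P +> 2 *: v) = hess d v v + 2 * d (P +> v) - d P.
    by rewrite (hessE P) // -mulr2n -scaler_nat; ring.
  by rewrite (quadratic_line2 _ _ t dQ) h2; field.
by move=> Q; rewrite avecK; ring.
Qed.

HB.instance Definition _ :=
  GRing.isSubmodClosed.Build R (A -> R^o) affine_fun affine_fun_submod.
HB.instance Definition _ :=
  GRing.isSubmodClosed.Build R (A -> R^o) quadratic_fun quadratic_fun_submod.

End AffineSpaceTheory.
Arguments affine_fun {R V} A.
Arguments quadratic_fun {R V} A.

Section AffQuad.
Context {R : realType} {V : vectType R} (A : affSpaceType V).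

Record Aff := MkAff { aff_fun :> A -> R^o; _ : aff_fun \in affine_fun A }.
HB.instance Definition _ := [isSub for aff_fun].
HB.instance Definition _ := [Choice of Aff by <:].
HB.instance Definition _ := [SubChoice_isSubLmodule of Aff by <:].

Record Quad := MkQuad { quad_fun :> A -> R^o; _ : quad_fun \in quadratic_fun A }.
HB.instance Definition _ := [isSub for quad_fun].
HB.instance Definition _ := [Choice of Quad by <:].
HB.instance Definition _ := [SubChoice_isSubLmodule of Quad by <:].

Lemma Aff_affine (f : Aff) : affine f. Proof. apply/asboolP; exact: (valP f). Qed.
Lemma Quad_quadratic (d : Quad) : quadratic d. Proof. apply/asboolP; exact: (valP d). Qed.

Lemma AffP (f g : Aff) : (forall P, f P = g P) -> f = g.
Proof. by move=> fg; apply/val_inj/funext. Qed.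
Lemma QuadP (d e : Quad) : (forall P, d P = e P) -> d = e.
Proof. by move=> de; apply/val_inj/funext. Qed.

Lemma AffE (f g : Aff) c P : (c *: f + g) P = c * f P + g P. Proof. by []. Qed.

Definition aff_of (f : A -> R^o) (fA : affine f) : Aff := MkAff (introT (asboolP _) fA).
Definition quad_of (d : A -> R^o) (dQ : quadratic d) : Quad :=
  MkQuad (introT (asboolP _) dQ).

Fact aff1_subproof : affine (fun _ : A => 1 : R^o).
Proof. by move=> a b P Q ab; rewrite !mulr1. Qed.
Definition aff1 : Aff := aff_of aff1_subproof.

Lemma affine_quadratic (f : A -> R^o) : affine f -> quadratic f.
Proof.
move=> fA a b P Q ab; have h : (2^-1 + 2^-1 : R) = 1 by lra.
rewrite (fA _ _ _ _ ab) (fA _ _ _ _ h); have -> : b = 1 - a by lra.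
by field.
Qed.

Definition quad_of_aff (s : Aff) : Quad := quad_of (affine_quadratic (@Aff_affine s)).

Definition aff_lin (f : Aff) (v : V) : R^o := f (origin +> v) - f origin.
Fact aff_lin_linear f : linear (aff_lin f).
Proof.
move=> c v w; rewrite /aff_lin affineD ?affineZ; [|exact: Aff_affine..].
by rewrite /GRing.scale /=; ring.
Qed.
HB.instance Definition _ f := GRing.isLinear.Build R V R^o *:%R (aff_lin f) (aff_lin_linear f).

Definition aff_coords (f : Aff) : R^o * 'Hom(V, R^o) := (f origin, linfun (aff_lin f)).
Fact aff_coords_linear : linear aff_coords.
Proof.
move=> c f g; congr pair; apply/lfunP => v.
rewrite add_lfunE scale_lfunE !lfunE.
by rewrite -[RHS]/(c * _ + _) /= /aff_lin !AffE; ring.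
Qed.

Fact aff_of_coords_subproof (x : R^o * 'Hom(V, R^o)) :
  affine (fun P : A => x.1 + x.2 (avec origin P)).
Proof.
by apply: (@affine_linear _ _ _ _ origin x.1 (fun v => x.2 v)) => // c v w; rewrite linearP.
Qed.
Definition aff_of_coords x : Aff := aff_of (aff_of_coords_subproof x).

Lemma aff_coordsK : cancel aff_coords aff_of_coords.
Proof.
move=> f; apply: AffP => P /=; rewrite lfunE /= /aff_lin avecK; ring.
Qed.

Lemma aff_of_coordsK : cancel aff_of_coords aff_coords.
Proof.
case=> c L; rewrite /aff_coords /=; congr pair.
  by rewrite -{2}(atrans0 origin) atransK linear0 addr0.
apply/lfunP => v; rewrite lfunE /= /aff_lin /= atransK.
by rewrite -{2}(atrans0 origin) atransK linear0; ring.
Qed.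

Import VectorInternalTheory.
Fact Aff_vect_iso : Vector.axiom (dim (R^o * 'Hom(V, R^o))%type) Aff.
Proof.
exists (v2r \o aff_coords).
  by move=> c f g; rewrite /= aff_coords_linear linearP.
exists (aff_of_coords \o r2v) => x /=; first by rewrite v2rK aff_coordsK.
by rewrite aff_of_coordsK r2vK.
Qed.
HB.instance Definition _ := Lmodule_hasFinDim.Build R Aff Aff_vect_iso.

Definition hessian (d : Quad) : V -> V -> R := hess d.

Fact hessian_bilinear d : bilinear_for *%R (idfun \; *%R) (hessian d).
Proof.
have dQ := @Quad_quadratic d.
split=> w c v1 v2 /=; rewrite /hessian.
  by rewrite !(hessC _ _ w) hessDr // hessZr.
by rewrite hessDr // hessZr.
Qed.
HB.instance Definition _ d :=
  bilinear_isBilinear.Build R V V R _ _ (hessian d) (hessian_bilinear d).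
Fact hessian_sym d v w : hessian d v w = (-1) ^+ false * idfun (hessian d w v).
Proof. by rewrite mul1r; exact: hessC. Qed.
HB.instance Definition _ d :=
  isHermitianSesquilinear.Build R V false idfun (hessian d) (hessian_sym d).

(* [Aff A], as a subspace of [Quad A]. *)
Definition affine_quad : {pred Quad} := [pred d : Quad | (d : A -> R^o) \in affine_fun A].
Fact affine_quad_zmod : zmod_closed affine_quad.
Proof.
split=> [|d e dA eA]; first exact: (rpred0 (affine_fun A)).
exact: (rpredB (S := affine_fun A) dA eA).
Qed.
HB.instance Definition _ := GRing.isZmodClosed.Build Quad affine_quad affine_quad_zmod.

Definition Met := Quotient.quot affine_quad.

Lemma Met_eqP (d e : Quad) : \pi_Met d = \pi_Met e <-> affine (fun P => d P - e P : R^o).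
Proof.
split=> [/eqP|h]; first by rewrite -Quotient.idealrBE => /asboolP.
by apply/eqP; rewrite -Quotient.idealrBE; apply/asboolP.
Qed.

(* The class [m], an affine space directed by [Aff A]. *)
Record Quadm (m : Met) := MkQuadm { quadm_quad :> Quad; _ : \pi_Met quadm_quad == m }.
HB.instance Definition _ m := [isSub for @quadm_quad m].

Lemma QuadmE m (d : Quadm m) : \pi_Met d = m. Proof. exact/eqP/(valP d). Qed.
Lemma QuadmP m (d e : Quadm m) : (forall P, d P = e P) -> d = e.
Proof. by move=> de; apply/val_inj/QuadP. Qed.

Section QuadmAffine.
Variable m : Met.

Fact quadm_trans_subproof (d : Quadm m) (s : Aff) :
  \pi_Met ((d : Quad) + quad_of_aff s) == m.
Proof.
rewrite -[X in _ == X](QuadmE d); apply/eqP/Met_eqP.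
have -> : (fun P => ((d : Quad) + quad_of_aff s) P - d P : R^o) = s; last exact: Aff_affine.
by apply/funext => P; have -> : ((d : Quad) + quad_of_aff s) P = d P + s P by []; ring.
Qed.
Definition quadm_trans (d : Quadm m) (s : Aff) : Quadm m := MkQuadm (quadm_trans_subproof d s).

Fact quadm_vec_subproof (d e : Quadm m) : affine (fun P => e P - d P : R^o).
Proof. by apply/Met_eqP; rewrite !QuadmE. Qed.
Definition quadm_vec (d e : Quadm m) : Aff := aff_of (quadm_vec_subproof d e).

Fact quadm_transD d s t : quadm_trans d (s + t) = quadm_trans (quadm_trans d s) t.
Proof. by apply: QuadmP => P; rewrite -[LHS]/(d P + (s P + t P)) addrA. Qed.
Fact quadm_vecK d e : quadm_trans d (quadm_vec d e) = e.
Proof. by apply: QuadmP => P; rewrite -[LHS]/(d P + (e P - d P)) addrC subrK. Qed.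
Fact quadm_transK d s : quadm_vec d (quadm_trans d s) = s.
Proof. by apply: AffP => P; rewrite -[LHS]/(d P + s P - d P) addrC addKr. Qed.
Fact quadm_inhabited : inhabited (Quadm m).
Proof. by exists; exists (repr m); rewrite reprK. Qed.

HB.instance Definition _ := isAffineSpace.Build R Aff (Quadm m)
  quadm_transD quadm_vecK quadm_transK quadm_inhabited.

End QuadmAffine.

End AffQuad.
Arguments aff1 {R V A}.

Lemma symformC (R : realType) (V : lmodType R) (g : {symmetric V}) v w :
  g v w = g w v.
Proof. by rewrite hermC mul1r. Qed.

Lemma symform_cross (R : realType) (V : lmodType R) (g : {symmetric V}) x w :
  2^-1 * g (- x + w) (- x + w) - 2^-1 * g w w
  - (2^-1 * g (- x) (- x) - 2^-1 * g 0 0) = - g x w.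
Proof.
rewrite hnormD hnormN linear0l linearNl mul1r /=.
by field.
Qed.

Lemma hessian_uniq (R : realType) (V : vectType R) (A : affSpaceType V)
    (d : Quad A) (b : {symmetric V}) :
  (forall P Q : A, 2^-1 * (d Q + d (comb 2 (-1) P Q)) - d P
                   = 2^-1 * b (avec P Q) (avec P Q)) ->
  forall v w, b v w = hessian d v w.
Proof.
move=> bE v w.
have E x : b x x = hessian d x x.
  have := bE origin (origin +> x).
  by rewrite (quadratic_hess _ _ (@Quad_quadratic _ _ _ d)) atransK /hessian; lra.
by have := E (v + w); rewrite !hnormD !E /= !mul1r; lra.
Qed.

Section Metric.
Context {R : realType} {V : vectType R} {A : affSpaceType V}.

(* All elements of the class [m] have the same hessian: [hessian_met]. *)
Definition met_hess (m : Met A) : {symmetric V} := hessian (repr m).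
Arguments met_hess : simpl never.

Lemma hessian_met m (d : Quadm m) v w : hessian d v w = met_hess m v w.
Proof.
have fA : affine (fun P => d P - repr m P : R^o).
  by apply/Met_eqP; rewrite QuadmE reprK.
have := affineD origin v w fA.
by rewrite -[met_hess m v w]/(hess (repr m : Quad A) v w) /hessian /hess => h; lra.
Qed.

Fact metdist_quadratic (g : {symmetric V}) P :
  quadratic (fun Q : A => 2^-1 * g (avec P Q) (avec P Q) : R^o).
Proof.
move=> a b X Y ab; have h : (2^-1 + 2^-1 : R) = 1 by lra.
rewrite (avec_comb P X Y ab) (avec_comb P X Y h).
move: (avec P X) (avec P Y) => x y.
have E s t : g (s *: x + t *: y) (s *: x + t *: y) =
    s ^+ 2 * g x x + 2 * s * t * g x y + t ^+ 2 * g y y.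
  rewrite linearDl !linearDr /= !linearZl_LR !linearZr_LR /=.
  by rewrite (symformC g y x); ring.
have -> : b = 1 - a by lra.
by rewrite !E; field.
Qed.

Fact met_delta_subproof m P :
  \pi_(Met A) (quad_of (metdist_quadratic (met_hess m) P)) == m.
Proof.
apply/eqP; rewrite -[RHS]reprK; apply/esym/Met_eqP.
exact: (quadratic_sub_affine P (@Quad_quadratic _ _ _ (repr m))).
Qed.

Definition met_delta m P : Quadm m := MkQuadm (met_delta_subproof m P).

End Metric.

Section LinearHull.
Context {R : realType} {V : vectType R}.

(* The linear hull, dual of [Aff A]. *)
Definition hull (A : affSpaceType V) := 'Hom(Aff A, R^o).
HB.instance Definition _ A := Vector.on (hull A).

Context {A : affSpaceType V}.

Definition aff_eval (P : A) (f : Aff A) : R^o := f P.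
Fact aff_eval_linear P : linear (aff_eval P).
Proof. by []. Qed.
HB.instance Definition _ P :=
  GRing.isLinear.Build R (Aff A) R^o *:%R (aff_eval P) (aff_eval_linear P).

Definition zpt P : hull A := linfun (aff_eval P).
Lemma zptE P f : zpt P f = f P. Proof. by rewrite lfunE. Qed.

(* The embedding of the director space as [{z | z aff1 = 0}], see [hull_dirP],
   [zvecK] and [zvec_avec]. *)
Definition zvec (v : V) : hull A := zpt (origin +> v) - zpt origin.

Lemma zvecE v P f : zvec v f = f (P +> v) - f P.
Proof.
rewrite add_lfunE opp_lfunE !zptE; exact: affine_trans (@Aff_affine _ _ _ _).
Qed.

Lemma zvec_avec P Q : zvec (avec P Q) = zpt Q - zpt P.
Proof. by apply/lfunP => f; rewrite (zvecE _ P) avecK add_lfunE opp_lfunE !zptE. Qed.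

End LinearHull.

Section HullDirection.
Context {R : realType} {V : vectType R} {A : affSpaceType V}.
Local Notation e := (vbasis {:V}).

Fact aff_coord_subproof i : affine (fun P : A => coord e i (avec origin P) : R^o).
Proof.
apply: (@affine_linear _ _ _ _ origin 0 (coord e i)) => [c v w|P]; last by rewrite add0r.
by rewrite linearP.
Qed.
Definition aff_coord i : Aff A := aff_of (aff_coord_subproof i).

(* The director part of [z] once [hull A] is split by [zpt origin]. *)
Definition hull_vec (z : hull A) : V := \sum_(i < \dim {:V}) z (aff_coord i) *: e`_i.

Lemma hull_vecE (z : hull A) (s : Aff A) :
  z s = z aff1 * s origin + aff_lin s (hull_vec z).
Proof.
have sE : s = s origin *: aff1 + \sum_(i < \dim {:V}) aff_lin s e`_i *: aff_coord i.
  apply: AffP => P; rewrite -[RHS]/(aff_eval P _) linearD linearZ linear_sum /=.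
  rewrite -[in LHS](avecK origin P) -[LHS](subrK (s origin)) -/(aff_lin s _).
  rewrite addrC /aff_eval -[_ *: _]/(_ * _) mulr1; congr (_ + _).
  rewrite {1}(coord_vbasis (memvf (avec origin P))) linear_sum.
  by apply: eq_bigr => i _; rewrite !linearZ; exact: mulrC.
rewrite {1}sE linearD linearZ !linear_sum /=; congr (_ + _); first exact: mulrC.
by apply: eq_bigr => i _; rewrite !linearZ; exact: mulrC.
Qed.

Lemma hull_dirP (z : hull A) : z aff1 = 0 -> z = zvec (hull_vec z).
Proof.
by move=> z0; apply/lfunP => s; rewrite hull_vecE z0 mul0r add0r (zvecE _ origin).
Qed.

Lemma zvec_aff1 v : zvec v (aff1 : Aff A) = 0.
Proof. by rewrite (zvecE _ origin) subrr. Qed.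

Fact hull_vec_linear : linear hull_vec.
Proof.
move=> c z t; rewrite /hull_vec scaler_sumr -big_split; apply: eq_bigr => i _ /=.
by rewrite add_lfunE scale_lfunE scalerDl scalerA.
Qed.
HB.instance Definition _ := GRing.isLinear.Build R (hull A) V *:%R hull_vec hull_vec_linear.

Lemma zvecK v : hull_vec (zvec v) = v.
Proof.
rewrite [RHS](coord_vbasis (memvf v)); apply: eq_bigr => i _.
by rewrite (zvecE _ origin) /= atransK -{2}[origin]atrans0 atransK linear0 subr0.
Qed.

Lemma hull_vec_zpt P : hull_vec (zpt P) = avec origin P.
Proof.
rewrite [RHS](coord_vbasis (memvf (avec origin P))); apply: eq_bigr => i _.
by rewrite zptE.
Qed.

End HullDirection.

Section CayleyMenger.
Context {R : realType} {V : vectType R} {A : affSpaceType V} (m : Met A).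
Local Notation g := (met_hess m).
Implicit Types (v w : Aff (Quadm m)) (P : A) (s : Aff A).

Lemma quadm_transE (d : Quadm m) s P : (d +> s) P = d P + s P.
Proof. by []. Qed.

Fact vpt_subproof P : affine (fun d : Quadm m => d P : R^o).
Proof.
move=> a b d e ab; have -> : comb a b d e P = d P + b * (e P - d P) by [].
have -> : a = 1 - b by lra.
ring.
Qed.
Definition vpt P : Aff (Quadm m) := aff_of (vpt_subproof P).

(* The differential, based at an arbitrary point of [Quadm m], see [dmetE]. *)
Definition dmet v : hull A := linfun (aff_lin v).

Lemma dmetE v (d : Quadm m) s : dmet v s = v (d +> s) - v d.
Proof. by rewrite lfunE /=; apply: affine_trans (@Aff_affine _ _ _ _). Qed.

Fact dmet_linear : linear dmet.
Proof.
move=> c v w; apply/lfunP => s.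
rewrite add_lfunE scale_lfunE !(dmetE _ origin) !AffE.
by rewrite -[RHS]/(c * _ + _); ring.
Qed.
HB.instance Definition _ :=
  GRing.isLinear.Build R (Aff (Quadm m)) (hull A) *:%R dmet dmet_linear.

Lemma dmet_vpt P : dmet (vpt P) = zpt P.
Proof.
apply/lfunP => s; rewrite (dmetE _ origin) zptE.
by rewrite -[LHS]/((origin : Quadm m) P + s P - (origin : Quadm m) P) addrC addKr.
Qed.

Definition Aff0 v := forall (d : Quadm m) (c : R), v (d +> c *: aff1) = v d.

Lemma Aff0P v : Aff0 v <-> dmet v aff1 = 0.
Proof.
split=> [v0|v0 d c]; first by rewrite (dmetE _ origin) -[aff1]scale1r v0 subrr.
by apply/eqP; rewrite -subr_eq0 -dmetE linearZ /= v0 scaler0.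
Qed.

Lemma dmet_Aff0 v : Aff0 v -> exists w : V, dmet v = zvec w.
Proof. by move=> /Aff0P/hull_dirP; exists (hull_vec (dmet v)). Qed.

(* The vectors [w1], [w2] exist and are unique by [dmet_Aff0] and [zvecK]; [zpt]
   on the right of the second clause is the embedding of [Quadm m] in its hull. *)
Definition cayley_menger_spec (b : {symmetric (Aff (Quadm m))}) :=
  (forall v1 v2, Aff0 v1 -> Aff0 v2 -> forall w1 w2 : V,
     dmet v1 = zvec w1 -> dmet v2 = zvec w2 -> b v1 v2 = - g w1 w2) /\
  (forall P v, b (vpt P) v = zpt (met_delta m P) v).

Lemma cayley_menger_uniq b b' : cayley_menger_spec b -> cayley_menger_spec b' ->
  forall v w, b v w = b' v w.
Proof.
move=> [b1 b2] [b1' b2'] v w.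
have dec x : exists2 x0, Aff0 x0 & x = x0 + dmet x aff1 *: vpt origin.
  exists (x - dmet x aff1 *: vpt origin); last by rewrite subrK.
  apply/Aff0P; rewrite linearB linearZ /= dmet_vpt add_lfunE opp_lfunE scale_lfunE zptE /=.
  by rewrite -[_ *: _]/(_ * _) mulr1 subrr.
have [v0 v00 ->] := dec v; rewrite !linearDl !linearZl_LR /= b2 b2'; congr (_ + _).
have [w0 w00 ->] := dec w; rewrite !linearDr !linearZr_LR /=.
rewrite ![_ v0 (vpt _)]symformC b2 b2'; congr (_ + _).
have [[x xE] [y yE]] := (dmet_Aff0 v00, dmet_Aff0 w00).
by rewrite (b1 _ _ v00 w00 _ _ xE yE) (b1' _ _ v00 w00 _ _ xE yE).
Qed.

Let form v w : R := dmet v aff1 * w (met_delta m origin) + dmet w aff1 * v (met_delta m origin)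
  - g (hull_vec (dmet v)) (hull_vec (dmet w)).

Let formC v w : form v w = (-1) ^+ false * idfun (form w v).
Proof. by rewrite mul1r /= /form symformC; ring. Qed.

Let form_linear v : linear_for *%R (form v).
Proof.
move=> c x y; rewrite /form AffE !linearP /= add_lfunE scale_lfunE.
rewrite -[_ *: dmet x aff1]/(_ * _); ring.
Qed.

Let form_bilinear : bilinear_for *%R (idfun \; *%R) form.
Proof.
split=> w c x y /=; last exact: form_linear.
by rewrite ![form _ w]formC !mul1r /= form_linear.
Qed.

Fact cayley_menger_exists : exists b, cayley_menger_spec b.
Proof.
pose B := bilinear_isBilinear.Build R _ _ R _ _ form form_bilinear.
pose H := isHermitianSesquilinear.Build R _ false idfun form formC.
pose b : {symmetric (Aff (Quadm m))} := HB.pack form B H.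
exists b; split=> [v1 v2 /Aff0P d1 /Aff0P d2 w1 w2 e1 e2|P v]; rewrite /b /= /form.
  by rewrite d1 d2 e1 e2 !zvecK !mul0r !add0r.
rewrite dmet_vpt hull_vec_zpt !zptE mul1r.
set dO := met_delta m origin; set dP := met_delta m P.
set s : Aff A := avec dO dP.
have -> : v dP = v dO + dmet v s by rewrite (dmetE _ dO) avecK addrC subrK.
rewrite (hull_vecE _ s); set w := hull_vec _.
have sE Q : s Q = 2^-1 * g (avec P Q) (avec P Q) - 2^-1 * g (avec origin Q) (avec origin Q).
  by [].
have av0 : avec (origin : A) origin = 0 by rewrite -{2}[origin]atrans0 atransK.
set x := avec origin P.
have xE : avec P origin = - x.
  by apply/eqP; rewrite -subr_eq0 opprK -avecD; apply/eqP; rewrite -{2}[P]atrans0 atransK.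
have lE : aff_lin s w = - g x w.
  rewrite /aff_lin !sE atransK av0 (avecD P origin) atransK xE.
  exact: symform_cross.
have dE : quad_fun dO P = 2^-1 * g x x by [].
rewrite lE sE av0 xE hnormN (linear0l g) -[vpt P dO]/(quad_fun dO P) dE.
by field.
Qed.

Definition CM : {symmetric (Aff (Quadm m))} := sval (cid cayley_menger_exists).

Lemma CMP : cayley_menger_spec CM. Proof. exact: svalP. Qed.

End CayleyMenger.

Section Signature.
Context {R : realType} {V : vectType R}.

(* Dimensions are bounded by that of [V], so this is a maximum over all
   subspaces satisfying [X] (see [max_dim_attained], [leq_max_dim]). *)
Definition max_dim (X : {vspace V} -> Prop) : nat :=
  (\max_(k < (\dim {:V}).+1 | `[< exists2 U, X U & \dim U = k >]) k)%N.

Lemma leq_max_dim (X : {vspace V} -> Prop) U : X U -> (\dim U <= max_dim X)%N.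
Proof.
move=> XU; have lt : (\dim U < (\dim {:V}).+1)%N by rewrite ltnS dimvS ?subvf.
by apply: (leq_bigmax_cond (Ordinal lt)); apply/asboolP; exists U.
Qed.

Lemma max_dim_attained (X : {vspace V} -> Prop) :
  (exists U, X U) -> exists2 U, X U & \dim U = max_dim X.
Proof.
move=> [U0 X0]; have lt : (\dim U0 < (\dim {:V}).+1)%N by rewrite ltnS dimvS ?subvf.
have P0 : `[< exists2 U, X U & \dim U = Ordinal lt >] by apply/asboolP; exists U0.
by rewrite /max_dim (bigop.bigmax_eq_arg _ P0) //; case: arg_maxnP => // k /asboolP[U]; exists U.
Qed.

Variable b : {symmetric V}.

Definition positive_definite (U : {vspace V}) :=
  {in U, forall x, x != 0 -> 0 < b x x}.
Definition negative_definite (U : {vspace V}) :=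
  {in U, forall x, x != 0 -> b x x < 0}.

Definition nullspace : {vspace V} := orthov b fullv.
Lemma nullspaceP x : reflect (forall y, b x y = 0) (x \in nullspace).
Proof.
by apply: (iffP mem_orthovP) => [h y|h y _]; [exact: h (memvf y) | exact: h].
Qed.

Definition signature : nat * nat * nat :=
  (max_dim positive_definite, max_dim negative_definite, \dim nullspace).

End Signature.

(* Main.v *)
Require Import Defs.
From mathcomp Require Import all_boot all_order all_algebra.
From mathcomp Require Import sesquilinear reals.
From HB Require Import structures.
From mathcomp Require Import boolp ring lra.

Set Implicit Arguments.
Unset Strict Implicit.
Unset Printing Implicit Defensive.

Import Order.TTheory GRing.Theory Num.Theory.
Local Open Scope ring_scope.

(** The space [Aff (Quadm m)] is, for the form [CM m], the orthogonal sum of a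
hyperbolic plane and a copy of the director space [V] carrying [- g], where
[g = met_hess m]. Write [O] for the origin of [A] and [d0] for the function
[Q |-> g(OQ, OQ) / 2] of the class [m]. The hyperbolic plane is spanned by the
evaluation [vpt m O] and the constant function [aff1]. Both are isotropic:
[CM m (vpt m O)] is evaluation at [d0], which vanishes at [O], and [aff1] has
zero differential. Their pairing is the value of [aff1] at [d0], which is 1.
The copy of [V] consists of the functionals with differential in the director
space and value 0 at [d0]: on them [CM m] is [- g] of the differentials, they
are orthogonal to [vpt m O] because they vanish at [d0], and to [aff1] because
its differential is zero. The three pieces span, since an affine functional on
[Quadm m] is determined by its value at [d0] and its differential
([Aff_Quadm_split]).

A hyperbolic plane adds one positive and one negative direction, passing from
[g] to [- g] exchanges the two inertia indices, and the nullspace is unchanged: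
this is [hyperbolic_signature]. It rests on Sylvester's law of inertia, in the
following form. A definite subspace which has a semidefinite complement of the
opposite sign has maximal dimension ([definite_max_dim]), and every form admits
such a pair of subspaces ([definite_complement]). It then suffices to exhibit
the pair for [CM m], built from one for [g]. *)

(** * Law of inertia *)

Section Definite.
Context {R : realType} {V : vectType R}.
Implicit Types (c : R) (b : {symmetric V}) (U P M : {vspace V}).

(** The scalar [c] plays the role of a sign, so that the positive and the negative
index are treated at once. *)
Definition definite c b U := {in U, forall x, x != 0 -> 0 < c * b x x}.
Definition semidefinite c b U := {in U, forall x, 0 <= c * b x x}.

Lemma positive_definiteE b : positive_definite b = definite 1 b.
Proof.
apply/funext => U; apply/propext.
by split=> h x xU x0; have := h x xU x0; rewrite mul1r.
Qed.

Lemma negative_definiteE b : negative_definite b = definite (-1) b.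
Proof.
apply/funext => U; apply/propext.
by split=> h x xU x0; have := h x xU x0; rewrite mulN1r oppr_gt0.
Qed.

Lemma definite0 c b : definite c b 0%VS.
Proof. by move=> x /[!memv0] ->. Qed.

Lemma definite_semidefinite c b U : definite c b U -> semidefinite c b U.
Proof.
move=> bU x xU; have [->|x0] := eqVneq x 0; last exact/ltW/bU.
by rewrite linear0l mulr0.
Qed.

Lemma definite_cap c b U M :
  definite c b U -> semidefinite (- c) b M -> (U :&: M = 0)%VS.
Proof.
move=> bU bM; apply/eqP; rewrite -subv0; apply/subvP => x.
rewrite memv_cap memv0 => /andP[xU xM].
by apply: contraT => /(bU x xU); rewrite ltNge -oppr_ge0 -mulNr bM.
Qed.

(** A definite subspace meets [M] trivially, so its dimension is at most the
codimension of [M], which is at most the dimension of [P]. *)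
Lemma definite_max_dim c b P M :
    definite c b P -> semidefinite (- c) b M -> (P + M = fullv)%VS ->
  max_dim (definite c b) = \dim P.
Proof.
move=> bP bM PM; apply/eqP; rewrite eqn_leq (leq_max_dim bP) andbT.
have [U bU <-] := max_dim_attained (ex_intro _ P bP).
rewrite -(leq_add2r (\dim M)) -(dimv_sum_cap U) (definite_cap bU bM) dimv0 addn0.
by rewrite (leq_trans _ (dimv_add_leqif P M))// PM dimvS ?subvf.
Qed.

(** The kernel of this map is the orthogonal of [U]; its rank is at most [\dim U],
which bounds the dimension of the orthogonal from below. *)
Definition pairing_row b U (x : V) : 'rV[R]_(\dim U) := \row_i b x (vbasis U)`_i.

Fact pairing_row_linear b U : linear (pairing_row b U).
Proof.
by move=> c x y; apply/rowP => i; rewrite !mxE linearDl linearZl_LR.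
Qed.
HB.instance Definition _ b U :=
  GRing.isLinear.Build R V _ *:%R (pairing_row b U) (pairing_row_linear b U).

(** No nonzero vector of [P] is orthogonal to [P], and the orthogonal of [P] has
codimension at most [\dim P]. *)
Lemma definite_orthov c b P : definite c b P -> (P + orthov b P = fullv)%VS.
Proof.
move=> bP; pose f := linfun (pairing_row b P).
have fM : (lker f <= orthov b P)%VS.
  apply/subvP => x; rewrite memv_ker lfunE => /eqP/rowP fx0.
  apply/mem_orthovP => y /coord_vbasis ->.
  rewrite linear_sumr big1 // => i _.
  by have := fx0 i; rewrite !mxE linearZr_LR /= => ->; rewrite mulr0.
have cap0 : (P :&: lker f = 0)%VS.
  apply/eqP; rewrite -subv0; apply/subvP => x.
  rewrite memv_cap memv0 => /andP[xP /(subvP fM)/mem_orthovP xM].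
  by apply: contraT => /(bP x xP); rewrite xM // mulr0 ltxx.
apply/eqP; rewrite eqEsubv subvf; apply: subv_trans (addvS (subvv P) fM).
rewrite -(geq_leqif (dimv_leqif_sup (subvf _))) dimv_disjoint_sum //.
rewrite -(limg_ker_dim f fullv) capfv addnC leq_add2r.
by rewrite (leq_trans (dimvS (subvf _))) // dimvf /dim /= mul1n.
Qed.

(** Take [P] definite of maximal dimension and [M] its orthogonal: a vector of [M]
with the sign of [P] could be added to [P]. *)
Lemma definite_complement c b : exists P M,
  [/\ definite c b P, semidefinite (- c) b M & (P + M = fullv)%VS].
Proof.
have [P bP maxP] := max_dim_attained (ex_intro _ _ (definite0 c b)).
exists P, (orthov b P); split=> //; last exact: definite_orthov bP.
move=> x /mem_orthovP xP; rewrite mulNr oppr_ge0 leNgt; apply/negP => bx.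
have xnP : x \notin P by apply/negP => /xP bxx; rewrite bxx mulr0 ltxx in bx.
have bPx : definite c b (P + <[x]>)%VS.
  move=> _ /memv_addP[p pP [_ /vlineP[k ->] ->]] y0.
  have -> : c * b (p + k *: x) (p + k *: x) = c * b p p + k ^+ 2 * (c * b x x).
    rewrite linearDl !linearDr /= !linearZl_LR !linearZr_LR /=.
    by rewrite (symformC b p x) xP //; ring.
  have [k0|k0] := eqVneq k 0.
    by rewrite k0 scale0r addr0 in y0 *; rewrite expr0n mul0r addr0 bP.
  rewrite ltr_wpDl ?(definite_semidefinite bP) // mulr_gt0 //.
  by rewrite lt0r sqrf_eq0 k0 sqr_ge0.
have := leq_max_dim bPx; rewrite -maxP (geq_leqif (dimv_leqif_sup (addvSl P <[x]>))).
by rewrite subv_add subvv -memvE (negPf xnP).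
Qed.

End Definite.

(** * Orthogonal sum with a hyperbolic plane *)

Section HyperbolicExtension.
Context {R : realType} {V W : vectType R}.
Variables (g : {symmetric V}) (b : {symmetric W}) (i : 'Hom(V, W)) (e u : W).
Hypotheses (be : b e e = 0) (bu : b u u = 0) (beu : b e u = 1).
Hypotheses (bei : forall x, b e (i x) = 0) (bui : forall x, b u (i x) = 0).
Hypothesis bi : forall x y, b (i x) (i y) = - g x y.
Hypothesis i_inj : injective i.
Hypothesis span : forall w, exists s t x, w = s *: e + t *: u + i x.

Lemma hyperbolic_pairing s t x s' t' x' :
  b (s *: e + t *: u + i x) (s' *: e + t' *: u + i x') = s * t' + t * s' - g x x'.
Proof.
rewrite !linearDl !linearDr /= !linearZl_LR !linearZr_LR /=.
rewrite (symformC b u e) !(symformC b (i x)) !bei !bui be bu beu.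
by rewrite (symformC b (i x')) bi; ring.
Qed.

(** The square of [e + k u] is [2 k], so that [e - c u] has the sign of [- c] and
[e + c u] that of [c], while [i] reverses signs. Hence a definite subspace [P] for
[c * g] and a complement [M] of opposite sign extend, by [e - c u] and [e + c u]
respectively, to such a pair for [- c * b]. *)
Lemma hyperbolic_max_dim c : c != 0 ->
  max_dim (definite (- c) b) = (max_dim (definite c g)).+1.
Proof.
move=> c0; have [P [M [gP gM PM]]] := definite_complement c g.
have pairE k t x : b (k *: (e + t *: u) + i x) (k *: (e + t *: u) + i x)
    = 2 * t * k ^+ 2 - g x x.
  by rewrite scalerDr scalerA hyperbolic_pairing; ring.
have bh k : b u (k *: (e - c *: u)) = k.
  rewrite linearZr_LR linearBr /= linearZr_LR /= symformC beu bu.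
  by rewrite mulr0 subr0 mulr1.
have c2 : 0 < c ^+ 2 by rewrite exprn_even_gt0.
rewrite (definite_max_dim gP gM PM).
rewrite (@definite_max_dim _ _ (- c) b (<[e - c *: u]> + i @: P)%VS
  (<[e + c *: u]> + i @: M)%VS).
- rewrite dimv_disjoint_sum.
    rewrite dim_vline limg_dim_eq.
      have [h0|//] := eqVneq.
      by have /eqP := bh 1; rewrite h0 scaler0 linear0r eq_sym oner_eq0.
    by rewrite (eqP (introT lker0P i_inj)) capv0.
  apply/eqP; rewrite -subv0; apply/subvP => w.
  rewrite memv_cap => /andP[/vlineP[k ->]] /memv_imgP[p _ kp].
  by rewrite -(bh k) kp bui scale0r mem0v.
- move=> _ /memv_addP[_ /vlineP[k ->] [_ /memv_imgP[p pP ->] ->]] y0.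
  rewrite -scaleNr pairE.
  have -> : - c * (2 * - c * k ^+ 2 - g p p) = 2 * c ^+ 2 * k ^+ 2 + c * g p p by ring.
  have gp := definite_semidefinite gP pP.
  have [k0|k0] := eqVneq k 0; last first.
    by rewrite ltr_wpDr // mulr_gt0 ?exprn_even_gt0 // mulr_gt0.
  rewrite k0 expr0n mulr0 add0r gP //; apply: contra_neq y0 => ->.
  by rewrite k0 scale0r linear0 addr0.
- move=> _ /memv_addP[_ /vlineP[k ->] [_ /memv_imgP[q qM ->] ->]].
  have -> : - - c * b (k *: (e + c *: u) + i q) (k *: (e + c *: u) + i q)
     = 2 * c ^+ 2 * k ^+ 2 + - c * g q q by rewrite pairE; ring.
  by rewrite addr_ge0 ?gM // mulr_ge0 ?sqr_ge0 // mulr_ge0 ?sqr_ge0.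
apply/eqP; rewrite eqEsubv subvf; apply/subvP => w _.
have [s [t [x ->]]] := span w.
have /memv_addP[p pP [q qM ->]] : x \in (P + M)%VS by rewrite PM memvf.
(* [e = ((e + c u) + (e - c u)) / 2] and [u = ((e + c u) - (e - c u)) / (2 c)] *)
have -> : s *: e + t *: u + i (p + q) =
   (((s - t / c) / 2) *: (e - c *: u) + i p) + (((s + t / c) / 2) *: (e + c *: u) + i q).
  rewrite addrACA -linearD; congr (_ + _).
  rewrite -scaleNr !scalerDr !scalerA addrACA -!scalerDl.
  by congr (_ *: _ + _ *: _); field.
by rewrite !memv_add // ?memv_line ?memvZ ?memv_line ?memv_img.
Qed.

(** Pairing with [u] and [e] reads off the two hyperbolic coordinates, which
therefore vanish on the nullspace. *)
Lemma hyperbolic_nullspace : \dim (nullspace b) = \dim (nullspace g).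
Proof.
suff -> : nullspace b = (i @: nullspace g)%VS.
  by rewrite limg_dim_eq // (eqP (introT lker0P i_inj)) capv0.
apply/vspaceP => w; apply/nullspaceP/memv_imgP => [bw|[x /nullspaceP gx ->] y].
  have [s [t [x wE]]] := span w; rewrite wE in bw *.
  have s0 : s = 0.
    have := bw (0 *: e + 1 *: u + i 0).
    by rewrite hyperbolic_pairing linear0r => <-; ring.
  have t0 : t = 0.
    have := bw (1 *: e + 0 *: u + i 0).
    by rewrite hyperbolic_pairing linear0r => <-; ring.
  exists x; last by rewrite s0 t0 !scale0r !add0r.
  apply/nullspaceP => y; have := bw (0 *: e + 0 *: u + i y).
  by rewrite hyperbolic_pairing s0 t0 => h; lra.
have [s [t [z ->]]] := span y.
have := hyperbolic_pairing 0 0 x s t z; rewrite !scale0r !add0r => ->.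
by rewrite gx; ring.
Qed.

Lemma hyperbolic_signature p n r :
  signature g = (p, n, r) -> signature b = (n.+1, p.+1, r).
Proof.
rewrite /signature !positive_definiteE !negative_definiteE => -[<- <- <-].
rewrite hyperbolic_nullspace hyperbolic_max_dim ?oner_neq0 //.
by rewrite -[X in definite X b]opprK hyperbolic_max_dim // oppr_eq0 oner_eq0.
Qed.

End HyperbolicExtension.

(** * The Cayley-Menger form *)

Lemma avec_diag (R : realType) (V : vectType R) (A : affSpaceType V) (P : A) :
  avec P P = 0.
Proof. by rewrite -{2}(atrans0 P) atransK. Qed.

Section CayleyMengerSplitting.
Context {R : realType} {V : vectType R} {A : affSpaceType V} (m : Met A).
Local Notation W := (Aff (Quadm m)).
Local Notation d0 := (met_delta m (origin : A)).

Fact vec_functional_subproof (x : V) :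
  affine (fun d : Quadm m => zvec x (avec d0 d) : R^o).
Proof.
apply: (@affine_linear _ _ _ _ d0 0 (zvec x)) => [c s t|d]; last by rewrite add0r.
by rewrite linearP.
Qed.

(** Subtracting the base point [d0] makes the copy of [V] vanish at [d0], that is,
makes it orthogonal to [vpt m origin]. *)
Definition vec_functional (x : V) : W := aff_of (vec_functional_subproof x).

Lemma zvec_linear : linear (zvec : V -> hull A).
Proof.
move=> c x y; apply/lfunP => f.
rewrite (zvecE (c *: x + y) origin) [RHS]add_lfunE scale_lfunE !(zvecE _ origin).
rewrite affineD ?affineZ; [|exact: Aff_affine..].
by rewrite -[_ *: _]/(_ * _); ring.
Qed.

Fact vec_functional_linear : linear vec_functional.
Proof.
move=> c x y; apply: AffP => d.
by rewrite AffE /= zvec_linear add_lfunE scale_lfunE.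
Qed.
HB.instance Definition _ :=
  GRing.isLinear.Build R V W *:%R vec_functional vec_functional_linear.

Lemma dmet_vec_functional x : dmet (vec_functional x) = zvec x.
Proof.
apply/lfunP => s; rewrite (dmetE _ d0) /= atransK.
by rewrite avec_diag linear0 subr0.
Qed.

Lemma dmet_aff1 : dmet (aff1 : W) = 0.
Proof. by apply/lfunP => s; rewrite (dmetE _ d0) subrr lfunE. Qed.

Lemma zvec0 : zvec 0 = 0 :> hull A.
Proof. by apply/lfunP => s; rewrite (zvecE _ origin) atrans0 subrr lfunE. Qed.

(** The coefficient [s] is the slope of [v] along the constant functions, which
makes [dmet v - s *: zpt origin] the image of a vector [x]; [d0] vanishes at the
origin, so [v d0] is the remaining constant. *)
Lemma Aff_Quadm_split (v : W) :
  exists s t x, v = s *: vpt m origin + t *: aff1 + vec_functional x.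
Proof.
pose s : R := dmet v aff1.
exists s, (v d0), (hull_vec (dmet v - s *: zpt origin)).
apply: AffP => d; set x := hull_vec _.
have xE : zvec x = dmet v - s *: zpt origin.
  rewrite -hull_dirP // add_lfunE opp_lfunE scale_lfunE zptE.
  by rewrite -[_ *: _]/(_ * _) mulr1 subrr.
rewrite -[RHS]/(s * d origin + v d0 * 1 + zvec x (avec d0 d)) xE.
rewrite add_lfunE opp_lfunE scale_lfunE zptE (dmetE _ d0) avecK.
have -> : avec d0 d origin = d origin - d0 origin by [].
have -> : d0 origin = 0 by rewrite /= avec_diag linear0l mulr0.
by rewrite -[_ *: _]/(_ * _); ring.
Qed.

End CayleyMengerSplitting.

Theorem corollary5p20 (R : realType) (V : vectType R) (A : affSpaceType V)
    (m : Met A) (p n r : nat) :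
  signature (met_hess m) = (p, n, r) ->
  signature (CM m) = (n.+1, p.+1, r).
Proof.
have [CMdir CMpt] := CMP m.
have aff1_dir : Aff0 (aff1 : Aff (Quadm m)) by [].
have aff1_zvec : dmet (aff1 : Aff (Quadm m)) = zvec 0 by rewrite dmet_aff1 zvec0.
have vec_dir x : Aff0 (vec_functional m x).
  by apply/Aff0P; rewrite dmet_vec_functional zvec_aff1.
pose i := linfun (vec_functional m).
have iE x : i x = vec_functional m x by rewrite lfunE.
apply: (@hyperbolic_signature _ _ _ _ _ i (vpt m origin) aff1).
- rewrite CMpt zptE /=.
  by rewrite avec_diag linear0l mulr0.
- by rewrite (CMdir _ _ _ _ 0 0) // linear0l oppr0.
- by rewrite CMpt zptE.
- move=> x; rewrite iE CMpt zptE /=.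
  by rewrite avec_diag linear0.
- by move=> x; rewrite iE (CMdir _ _ _ _ 0 x) ?dmet_vec_functional // linear0l oppr0.
- by move=> x y; rewrite !iE; apply: CMdir; rewrite ?dmet_vec_functional.
- move=> x y; rewrite !iE => /(congr1 (@dmet _ _ _ _)).
  by rewrite !dmet_vec_functional => /(congr1 (@hull_vec _ _ _)); rewrite !zvecK.
- move=> v; have [s [t [x ->]]] := Aff_Quadm_split v.
  by exists s, t, x; rewrite iE.
Qed.
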